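(* Let $G$ be a simple graph with $n\ge 2$ vertices whose $2$-Laplacian $L^{(2)}_G$ is positive semi-definite. Let $\lambda_2$ and $\mu_2$ be the second smallest eigenvalues (counted with multiplicity) of $L^{(2)}_G$ and of the ordinary Laplacian $L_G$, respectively. Then \[ \frac{4}{3}\mu_2-\frac{n(n-2)}{6}\;\le\;\lambda_2\;\le\;\frac{4}{3}\mu_2. \]
   Context: For a simple graph $G$ with adjacency matrix $A_G$ and degree matrix $D_G$ (diagonal matrix of vertex degrees), the ordinary Laplacian is $L_G=D_G-A_G$. Let $A'=\frac{1}{12}\left(16A_G-A_G^2+D_G\right)$ and let $D'$ be the diagonal matrix whose $(i,i)$ entry is the sum of the entries of the $i$th row of $A'$. The $2$-Laplacian of $G$ is $L^{(2)}_G=D'-A'$. *)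

(* Defs.v *)
From mathcomp Require Import all_boot all_order all_algebra.
From mathcomp Require Export polyrcf.

Set Implicit Arguments.
Unset Strict Implicit.
Unset Printing Implicit Defensive.

Import Order.TTheory GRing.Theory Num.Theory.
Local Open Scope ring_scope.

Record sgraph (n : nat) := SGraph {
  adj : rel 'I_n;
  adj_sym : symmetric adj;
  adj_irrefl : irreflexive adj
}.

Definition degree (n : nat) (G : sgraph n) (i : 'I_n) : nat :=
  #|[set j | adj G i j]|.

Definition adjmx (R : rcfType) (n : nat) (G : sgraph n) : 'M[R]_n :=
  \matrix_(i, j) (adj G i j)%:R.

Definition degmx (R : rcfType) (n : nat) (G : sgraph n) : 'M[R]_n :=
  diag_mx (\row_i (degree G i)%:R).

Definition laplacian (R : rcfType) (n : nat) (G : sgraph n) : 'M[R]_n :=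
  degmx R G - adjmx R G.

Definition rowsum_mx (R : rcfType) (n : nat) (M : 'M[R]_n) : 'M[R]_n :=
  diag_mx (\row_i \sum_j M i j).

Definition adjmx2 (R : rcfType) (n : nat) (G : sgraph n) : 'M[R]_n :=
  12^-1 *: (16 *: adjmx R G - adjmx R G *m adjmx R G + degmx R G).

Definition laplacian2 (R : rcfType) (n : nat) (G : sgraph n) : 'M[R]_n :=
  rowsum_mx (adjmx2 R G) - adjmx2 R G.

Definition psdmx (R : rcfType) (n : nat) (M : 'M[R]_n) : Prop :=
  M^T = M /\ forall v : 'cV[R]_n, 0 <= (v^T *m M *m v) 0 0.

(* The roots in R of the characteristic polynomial, in nondecreasing order,
   each repeated according to its algebraic multiplicity.  For a symmetric
   n x n matrix all the eigenvalues are in R and this sequence has size n. *)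
Definition eigvals (R : rcfType) (n : nat) (M : 'M[R]_n) : seq R :=
  sort <=%R
    (flatten [seq nseq (mup x (char_poly M)) x | x <- rootsR (char_poly M)]).

(* Indexing starts at 0, so `_1 is the second entry; the default value 0 of
   s`_1 is only reached when there are fewer than two real eigenvalues. *)
Definition second_eigval (R : rcfType) (n : nat) (M : 'M[R]_n) : R :=
  (eigvals M)`_1.

(* Main.v *)
(* The quadratic form of rowsum_mx W - W, for W symmetric, is
   (1/2) sum_ij W_ij (v_i - v_j)^2.  Off the diagonal the entries of adjmx2
   are (16 a_ij - c_ij) / 12, where c_ij counts the common neighbours of i and
   j and lies between 0 and n - 2.  Hence, as quadratic forms,
     4/3 L - n (n - 2) / 12 <= L2 <= 4/3 L,
   because sum_ij (v_i - v_j)^2 <= 2 n |v|^2, and the second smallest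
   eigenvalue is monotone in the quadratic form (Courant-Fischer).  The
   spectral theorem is used over the complex numbers R[i]; the real part of the
   Hermitian form of a real matrix at x + iy is the sum of its values at x and
   at y, so inequalities between real quadratic forms extend. *)
Require Import Defs.
From mathcomp Require Import all_boot all_order all_algebra all_fingroup.
From mathcomp Require Import complex spectral sesquilinear ring lra.

Set Implicit Arguments.
Unset Strict Implicit.
Unset Printing Implicit Defensive.

Import Order.TTheory GRing.Theory Num.Theory.
Local Open Scope ring_scope.
Local Open Scope complex_scope.
Local Open Scope sesquilinear_scope.

(** * Characteristic polynomials and lists of eigenvalues *)

Lemma eigvals_perm (R : rcfType) (n : nat) (M : 'M[R]_n) (s : seq R) :
  char_poly M = \prod_(x <- s) ('X - x%:P) -> perm_eq (eigvals M) s.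
Proof.
move=> defp; rewrite /eigvals perm_sort; apply/allP => x _ /=; apply/eqP.
have p0 : char_poly M != 0 by rewrite monic_neq0 ?char_poly_monic.
have mup_count y : mup y (char_poly M) = count_mem y s.
  by rewrite defp mu_prod_XsubC.
have -> (r : seq R) :
    count_mem x (flatten [seq nseq (mup y (char_poly M)) y | y <- r])
    = (count_mem x r * mup x (char_poly M))%N.
  elim: r => //= y r IHr; rewrite count_cat count_nseq IHr mulnDl /=.
  by case: eqP => [->|_].
(* The list of roots has no repetition, so [x] is counted exactly as often as its multiplicity, or
   not at all. *)
rewrite count_uniq_mem; last exact: polyrcf.uniq_roots.
have <- := roots_on_rootsR p0 x.
rewrite in_itv /= mup_count defp root_prod_XsubC.
by case: (boolP (x \in s)) => [|/count_memPn ->]; rewrite ?mul1n.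
Qed.

Lemma char_poly_conj (F : comUnitRingType) (n : nat) (P D : 'M[F]_n) :
  P \in unitmx -> char_poly (invmx P *m D *m P) = char_poly D.
Proof.
move=> uP; rewrite /char_poly /char_poly_mx.
have -> : 'X%:M - map_mx polyC (invmx P *m D *m P)
    = map_mx polyC (invmx P) *m ('X%:M - map_mx polyC D) *m map_mx polyC P.
  rewrite mulmxBr mulmxBl !map_mxM; congr (_ - _).
  by rewrite scalar_mxC -mulmxA -map_mxM mulVmx // map_mx1 mulmx1.
rewrite !det_mulmx mulrAC -det_mulmx -map_mxM mulVmx //.
by rewrite map_mx1 det1 mul1r.
Qed.

(** * Quadratic and Hermitian forms, spectral theorem *)

Definition sqmod (R : rcfType) (z : R[i]) : R :=
  complex.Re z ^+ 2 + complex.Im z ^+ 2.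

Lemma Re_mulJ (R : rcfType) (z : R[i]) (a : R) :
  complex.Re (z * a%:C * z^* ) = a * sqmod z.
Proof. by case: z => x y; rewrite /sqmod /=; ring. Qed.

(** Values lie in [R], where they can be ordered. Vectors are rows because the rows of the spectral
    matrix are the eigenvectors. *)
Definition hform (R : rcfType) n (M : 'M[R]_n) (x : 'rV[R[i]]_n) : R :=
  complex.Re ((x *m map_mx (real_complex R) M *m x^t* ) 0 0).

Definition qform (R : rcfType) n (M : 'M[R]_n) (v : 'cV[R]_n) : R :=
  (v^T *m M *m v) 0 0.

Lemma qformE (R : rcfType) n (M : 'M[R]_n) (v : 'cV[R]_n) :
  qform M v = \sum_i \sum_j M i j * (v i 0 * v j 0).
Proof.
rewrite /qform mxE [RHS]exchange_big; apply: eq_bigr => j _ /=.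
rewrite mxE mulr_suml; apply: eq_bigr => i _; rewrite mxE; ring.
Qed.

Lemma hformE (R : rcfType) n (M : 'M[R]_n) (x : 'rV[R[i]]_n) :
  hform M x =
    qform M (\col_i complex.Re (x 0 i)) + qform M (\col_i complex.Im (x 0 i)).
Proof.
rewrite /hform !qformE -big_split mxE raddf_sum.
under [RHS]eq_bigr do rewrite -big_split.
rewrite [RHS]exchange_big; apply: eq_bigr => j _.
rewrite [(x *m _) _ _]mxE mulr_suml raddf_sum.
apply: eq_bigr => i _; rewrite !mxE /=.
by case: (x 0 j) => a b; case: (x 0 i) => c d /=; ring.
Qed.

Lemma spectral_sym (R : rcfType) n (M : 'M[R]_n) : M^T = M ->
  exists (P : 'M[R[i]]_n) (e : 'I_n -> R),
    [/\ P \is unitarymx, eigvals M = codom e,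
        {homo e : i j / (i <= j)%N >-> i <= j}
      & forall z, hform M (z *m P) = \sum_k e k * sqmod (z 0 k)].
Proof.
move=> symM; set C := map_mx (real_complex R) M.
have hermC : C \is hermsymmx.
  apply/is_hermitianmxP; rewrite expr0 scale1r; apply/matrixP => i j.
  by rewrite !mxE -{1}symM mxE; symmetry; exact: conjc_real.
have realD := hermitian_spectral_diag_real hermC.
have /orthomx_spectralP := hermitian_normalmx hermC.
have := spectral_unitarymx C.
move: (spectralmx C) (spectral_diag C) realD => P D /mxOverP realD uP defC.
pose d i := complex.Re (D 0 i).
(* A Hermitian matrix has real eigenvalues. *)
have dE i : D 0 i = (d i)%:C by rewrite [RHS]RRe_real.
have charM : char_poly M = \prod_(x <- codom d) ('X - x%:P).
  apply: (@map_poly_inj _ _ (real_complex R)).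
  rewrite map_char_poly -/C defC char_poly_conj ?unitarymx_unit //.
  rewrite char_poly_trig ?diag_mx_is_trig // map_prod_XsubC big_image /=.
  by apply: eq_bigr => i _; rewrite mxE eqxx mulr1n dE.
have formD z : hform M (z *m P) = \sum_k d k * sqmod (z 0 k).
  rewrite /hform -/C defC invmx_unitary // trmx_mul map_mxM !mulmxA.
  rewrite !mulmxtVK // mul_mx_diag mxE raddf_sum; apply: eq_bigr => k _.
  rewrite !mxE dE; exact: Re_mulJ.
(* The diagonal [d] comes in no particular order; [p] sorts it, and the rows of [P] are permuted to
   match. *)
have /(@tuple_permP _ _ _ [tuple d i | i < n])[p defs] :
    perm_eq (eigvals M) (mktuple d) by exact: eigvals_perm.
exists (perm_mx p *m P), (d \o p); split.
- rewrite mul_unitarymx //; apply/unitarymxP.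
  by rewrite tr_perm_mx map_perm_mx -perm_mxM mulgV perm_mx1.
- by rewrite defs; apply: eq_map => i /=; rewrite tnth_mktuple.
- move=> i j le_ij; have := sort_sorted (@le_total _ R) (flatten
    [seq nseq (mup x (char_poly M)) x | x <- rootsR (char_poly M)]).
  rewrite -/(eigvals M) defs => /(sorted_leq_nth le_trans lexx 0) /(_ i j).
  rewrite !inE size_tuple !ltn_ord => /(_ isT isT le_ij).
  by rewrite -!tnth_nth !tnth_mktuple.
move=> z; rewrite mulmxA formD (reindex_inj (@perm_inj _ p)) /=.
apply: eq_bigr => k _; congr (_ * sqmod _).
by rewrite -[p in perm_mx p]invgK -col_permE mxE permK.
Qed.

Lemma hform1 (R : rcfType) n (P : 'M[R[i]]_n) (z : 'rV[R[i]]_n) :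
  P \is unitarymx -> hform 1%:M (z *m P) = \sum_k sqmod (z 0 k).
Proof.
move=> uP; rewrite /hform map_mx1 mulmx1 trmx_mul map_mxM mulmxA mulmxtVK //.
rewrite mxE raddf_sum; apply: eq_bigr => k _.
by rewrite !mxE -[RHS]mul1r -Re_mulJ mulr1.
Qed.

(** * Comparison of second eigenvalues *)

Lemma sqmod_ge0 (R : rcfType) (z : R[i]) : 0 <= sqmod z.
Proof. by rewrite addr_ge0 ?sqr_ge0. Qed.

Lemma sqmod_gt0 (R : rcfType) (z : R[i]) : z != 0 -> 0 < sqmod z.
Proof.
rewrite lt_def sqmod_ge0 andbT; apply: contra_neq; case: z => x y.
rewrite /sqmod /= => /eqP.
by rewrite paddr_eq0 ?sqr_ge0 // !sqrf_eq0 => /andP[/eqP-> /eqP->].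
Qed.

(* A vector x in the span of the first two eigenvectors of B and orthogonal to
   the first one of A has Rayleigh quotients at most the second eigenvalue of B
   and at least the second eigenvalue of A. *)
Lemma second_eigval_le (R : rcfType) n (A B : 'M[R]_n) (a c : R) :
    (2 <= n)%N -> A^T = A -> B^T = B -> 0 <= a ->
    (forall v, qform A v <= a * qform B v + c * qform 1%:M v) ->
  second_eigval A <= a * second_eigval B + c.
Proof.
case: n A B => [|[|n]] // A B _ symA symB a_ge0 leAB.
have [P [d [uP eigA dS formA]]] := spectral_sym symA.
have [Q [e [uQ eigB eS formB]]] := spectral_sym symB.
have nth1 (f : 'I_n.+2 -> R) : (codom f)`_1 = f (lift ord0 ord0).
  rewrite (nth_map ord0) ?size_enum_ord //; congr f.
  by apply: val_inj; rewrite /= nth_enum_ord.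
rewrite /second_eigval eigA eigB !nth1; set i1 : 'I_n.+2 := lift ord0 ord0.
(* Change of basis: coordinates [y] in the eigenbasis of [B] become [y *m U] in that of [A]. *)
set U := Q *m P^t*.
(* One linear equation in two unknowns has a nonzero solution; it makes the coordinate along the
   first eigenvector of [A] vanish. *)
have [al [be [ab0 abU]]] : exists al be : R[i],
    0 < sqmod al + sqmod be /\ al * U ord0 ord0 + be * U i1 ord0 = 0.
  have [U0|U0] := eqVneq (U i1 ord0) 0.
    exists 0, 1; rewrite U0 mul0r mulr0 addr0; split=> //.
    by rewrite ltr_wpDl ?sqmod_ge0 ?sqmod_gt0 ?oner_eq0.
  exists (U i1 ord0), (- U ord0 ord0); split; last by ring.
  by rewrite ltr_pwDl ?sqmod_ge0 ?sqmod_gt0.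
pose y : 'rV[R[i]]_n.+2 := al *: delta_mx 0 ord0 + be *: delta_mx 0 i1.
have sumy f : \sum_k f k * sqmod (y 0 k) = f ord0 * sqmod al + f i1 * sqmod be.
  rewrite !big_ord_recl big1 => [|k _].
    by rewrite !mxE /= !(mulr0, mulr1, addr0, add0r).
  by rewrite !mxE /= !(mulr0, addr0) /sqmod /= expr0n addr0 mulr0.
pose z := y *m U; have z0 : z 0 ord0 = 0.
  by rewrite /z mulmxDl -!scalemxAl -!rowE -abU; move: (U) => V; rewrite !mxE.
have zP : z *m P = y *m Q by rewrite /z /U mulmxA mulmxKtV.
have leq1 : hform A (y *m Q) <= a * hform B (y *m Q) + c * hform 1%:M (y *m Q).
  by rewrite !hformE !mulrDr addrACA lerD.
have ge_A : d i1 * \sum_k sqmod (z 0 k) <= hform A (y *m Q).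
  rewrite -zP formA mulr_sumr; apply: ler_sum => k _.
  have [->|k_neq0] := eqVneq k ord0.
    by rewrite z0 /sqmod /= expr0n addr0 !mulr0.
  by rewrite ler_wpM2r ?sqmod_ge0 // dS // lt0n.
have le_B : hform B (y *m Q) <= e i1 * (sqmod al + sqmod be).
  by rewrite formB sumy [leRHS]mulrDr lerD2r ler_wpM2r ?sqmod_ge0 // eS.
have normx : hform 1%:M (y *m Q) = sqmod al + sqmod be.
  by rewrite hform1 // -[LHS]mul1r mulr_sumr (sumy (fun=> 1)) !mul1r.
have normz : \sum_k sqmod (z 0 k) = sqmod al + sqmod be.
  by rewrite -(hform1 _ uP) zP.
rewrite -(ler_pM2r ab0) -{1}normz.
apply: (le_trans ge_A); apply: (le_trans leq1).
by rewrite normx mulrDl lerD2r -mulrA ler_wpM2l.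
Qed.

(** * Laplacian forms as sums of squared differences *)

Lemma qform_lap (R : rcfType) n (W : 'M[R]_n) (v : 'cV[R]_n) : W^T = W ->
  \sum_i \sum_j W i j * (v i 0 - v j 0) ^+ 2 = 2 * qform (rowsum_mx W - W) v.
Proof.
move=> symW; have WC i j : W i j = W j i by rewrite -{1}symW mxE.
have -> : qform (rowsum_mx W - W) v =
    \sum_i \sum_j W i j * v i 0 ^+ 2 - \sum_i \sum_j W i j * (v i 0 * v j 0).
  rewrite qformE -sumrB; apply: eq_bigr => i _.
  rewrite (eq_bigr (fun j => (\sum_k W i k) *+ (i == j) * (v i 0 * v j 0)
    - W i j * (v i 0 * v j 0))); last by move=> j _; rewrite !mxE mulrBl.
  rewrite sumrB; congr (_ - _).
  rewrite (bigD1 i) //= eqxx mulr1n [X in _ + X]big1 => [|j].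
    by rewrite addr0 -mulr_suml expr2.
  by rewrite eq_sym => /negPf->; rewrite mulr0n mul0r.
have symS :
    \sum_i \sum_j W i j * v i 0 ^+ 2 = \sum_i \sum_j W i j * v j 0 ^+ 2.
  rewrite exchange_big; apply: eq_bigr => i _; apply: eq_bigr => j _.
  by rewrite WC.
rewrite mulrBr [X in _ = X - _]mulr_natl mulr2n {2}symS mulr_sumr.
rewrite -big_split -sumrB; apply: eq_bigr => i _.
rewrite mulr_sumr -big_split -sumrB; apply: eq_bigr => j _ /=.
by ring.
Qed.

(** The two sides differ by twice the square of the sum of the entries of [v]. *)
Lemma sum_sqr_diff_le (R : rcfType) n (v : 'cV[R]_n) :
  \sum_i \sum_j (v i 0 - v j 0) ^+ 2 <= 2 * n%:R * qform 1%:M v.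
Proof.
have -> : qform 1%:M v = \sum_i v i 0 ^+ 2.
  by rewrite /qform mulmx1 mxE; apply: eq_bigr => i _; rewrite mxE expr2.
set S2 := \sum_i v i 0 ^+ 2; pose S := \sum_i v i 0.
suff -> : \sum_i \sum_j (v i 0 - v j 0) ^+ 2 = 2 * n%:R * S2 - 2 * S ^+ 2.
  by rewrite lerBlDr lerDl mulr_ge0 ?sqr_ge0.
transitivity (\sum_i (n%:R * v i 0 ^+ 2 + S2 - 2 * (v i 0 * S))).
  apply: eq_bigr => i _.
  rewrite (eq_bigr (fun j => v i 0 ^+ 2 + v j 0 ^+ 2 - 2 * (v i 0 * v j 0))).
    rewrite sumrB big_split sumr_const card_ord /=.
    by rewrite -[_ *+ n]mulr_natl -!mulr_sumr.
  by move=> j _; ring.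
rewrite sumrB big_split sumr_const card_ord -!mulr_sumr -mulr_suml.
by rewrite -[_ *+ n]mulr_natl -/S -/S2 /=; ring.
Qed.

(** * Symmetry and entrywise bounds of the graph matrices *)

Lemma adjmx_sym (R : rcfType) n (G : sgraph n) : (adjmx R G)^T = adjmx R G.
Proof. by apply/matrixP => i j; rewrite !mxE adj_sym. Qed.

Lemma adjmx2_sym (R : rcfType) n (G : sgraph n) : (adjmx2 R G)^T = adjmx2 R G.
Proof.
rewrite /adjmx2 linearZ /= linearD linearB linearZ /=.
by rewrite trmx_mul tr_diag_mx !adjmx_sym.
Qed.

(** Gives both Laplacians the same shape, so that [qform_lap] applies to each. *)
Lemma laplacianE (R : rcfType) n (G : sgraph n) :
  laplacian R G = rowsum_mx (adjmx R G) - adjmx R G.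
Proof.
congr (diag_mx _ - _); apply/rowP => i; rewrite !mxE.
rewrite /degree -sum1dep_card natr_sum big_mkcond.
by apply: eq_bigr => j _; rewrite !mxE; case: adj.
Qed.

Lemma lap_sym (R : rcfType) n (W : 'M[R]_n) : W^T = W ->
  (rowsum_mx W - W)^T = rowsum_mx W - W.
Proof. by move=> symW; rewrite linearB /= tr_diag_mx symW. Qed.

Lemma common_neighbours_bound (R : rcfType) n (G : sgraph n) i j : i != j ->
  0 <= (adjmx R G *m adjmx R G) i j <= n%:R - 2.
Proof.
move=> neq_ij; rewrite mxE sumr_ge0 => [/=|k _]; last by rewrite !mxE mulr_ge0.
(* The bound becomes the number of [k] other than [i] and [j], to be compared term by term; without
   loops, neither [i] nor [j] is a common neighbour. *)
have -> : n%:R - 2 = \sum_(k < n) (1 - (k == i)%:R - (k == j)%:R) :> R.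
  have sum1 (l : 'I_n) : \sum_(k < n) (k == l)%:R = 1 :> R.
    by rewrite (bigD1 l) //= eqxx big1 ?addr0 // => k /negPf->.
  by rewrite !sumrB !sum1 sumr_const card_ord -addrA -opprD.
apply: ler_sum => k _; rewrite !mxE.
have [->|_] := eqVneq k i.
  by rewrite adj_irrefl mul0r (negPf neq_ij) subrr subr0.
have [->|_] := eqVneq k j; first by rewrite adj_irrefl mulr0 !subr0 subrr.
by rewrite !subr0 -natrM lern1; do 2!case: adj.
Qed.

Lemma adjmx2_bound (R : rcfType) n (G : sgraph n) i j : i != j ->
  4 / 3 * adjmx R G i j - (n%:R - 2) / 12 <= adjmx2 R G i j
    <= 4 / 3 * adjmx R G i j.
Proof.
move=> neq_ij; have /andP[] := common_neighbours_bound R G neq_ij.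
have -> : adjmx2 R G i j =
    12^-1 * (16 * adjmx R G i j - (adjmx R G *m adjmx R G) i j).
  by rewrite mxE [in LHS]mxE [degmx R G i j]mxE (negPf neq_ij) addr0 !mxE.
by move=> c_ge0 c_le; apply/andP; split; lra.
Qed.

Theorem theorem6p16 (R : rcfType) (n : nat) (G : sgraph n)
    (hn : (2 <= n)%N) (hpsd : psdmx (laplacian2 R G)) :
  4 / 3 * second_eigval (laplacian R G) - n%:R * (n%:R - 2) / 6
    <= second_eigval (laplacian2 R G)
  /\ second_eigval (laplacian2 R G) <= 4 / 3 * second_eigval (laplacian R G).
Proof.
have symL : (laplacian R G)^T = laplacian R G.
  by rewrite laplacianE lap_sym ?adjmx_sym.
have symL2 := lap_sym (adjmx2_sym R G).
have n2 : 0 <= n%:R - 2 :> R by rewrite subr_ge0 ler_nat.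
have formL v := qform_lap v (adjmx_sym R G).
have formL2 v := qform_lap v (adjmx2_sym R G).
split; last first.
  rewrite -[leRHS]addr0; apply: second_eigval_le => // [|v]; first by lra.
  rewrite mul0r addr0 -(ler_pM2l (ltr0n R 2)) mulrCA laplacianE -formL -formL2.
  rewrite mulr_sumr ler_sum // => i _; rewrite mulr_sumr ler_sum // => j _.
  (* Diagonal entries carry a zero difference, so off-diagonal bounds suffice. *)
  have [->|neq_ij] := eqVneq i j; first by rewrite subrr expr0n !mulr0.
  rewrite [leRHS]mulrA ler_wpM2r ?sqr_ge0 //.
  by have /andP[] := adjmx2_bound R G neq_ij.
(* Solved for the ordinary eigenvalue, to fit [second_eigval_le]. Multiplied by 4/3, the error is
   n(n-2)/12, at most the claimed n(n-2)/6. *)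
suff : second_eigval (laplacian R G) <=
    3 / 4 * second_eigval (laplacian2 R G) + n%:R * (n%:R - 2) / 16.
  have : 0 <= n%:R * (n%:R - 2) :> R by rewrite mulr_ge0.
  by lra.
apply: second_eigval_le => // [|v]; first by lra.
have le_v := sum_sqr_diff_le v.
(* The constant is 3/4 of the entrywise error (n-2)/12. *)
suff : 2 * qform (laplacian R G) v <= 3 / 4 * (2 * qform (laplacian2 R G) v)
    + (n%:R - 2) / 16 * \sum_i \sum_j (v i 0 - v j 0) ^+ 2.
  have := ler_wpM2l n2 le_v.
  by lra.
rewrite laplacianE -formL -formL2 !mulr_sumr -big_split ler_sum // => i _.
rewrite !mulr_sumr -big_split ler_sum // => j _ /=.
have [->|neq_ij] := eqVneq i j; first by rewrite subrr expr0n !mulr0 addr0.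
rewrite [X in _ <= X + _]mulrA -mulrDl ler_wpM2r ?sqr_ge0 //.
by have /andP[] := adjmx2_bound R G neq_ij; lra.
Qed.
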